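(* For all typing contexts $\Gamma$, formulas $A$ and terms $u,v$: if $\Gamma\vdash_{\mathtt{NI}^p}u\rightsquigarrow_{\beta\eta\gamma}v:A$, then $\Gamma^*\vdash_{\mathtt{NI}^2_{at}}u^\sharp\simeq_{\beta\eta}v^\sharp:A^*$, where $(\cdot)^\sharp$ is the ESF-translation.
   Context: Notation for lists: for a finite (possibly empty) list $\mathcal A=\langle a_1,\dots,a_n\rangle$, $\langle A_a\rangle_{a\in\mathcal A}\supset B$ abbreviates $A_{a_1}\supset\dots\supset A_{a_n}\supset B$ (just $B$ if $\mathcal A$ is empty); $\lambda\langle x_a\rangle.t$ abbreviates $\lambda x_{a_1}\dots\lambda x_{a_n}.t$ and $t\langle u_a\rangle$ abbreviates $t\,u_{a_1}\cdots u_{a_n}$. Polynomial connectives. A polynomial connective $\dagger$ is given by finite (possibly empty) lists $\mathcal I,\mathcal J,\mathcal K$ and functions $f:\mathcal J\to\mathcal I$, $g:\mathcal J\to\mathcal K$; $g^{-1}(k)$ is the sublist of the $j\in\mathcal J$ with $g(j)=k$. It forms a formula $\dagger\langle A_i\rangle_{i\in\mathcal I}$. Formulas. $\mathcal L^p$: $A::=X\mid A\supset B\mid\dagger\langle A_i\rangle$; $\mathcal L^2$: $A::=X\mid A\supset B\mid\forall X.A$. System $\mathtt{NI}^p$ over $\mathcal L^p$: terms $t::=x\mid\lambda x.t\mid tu\mid\iota_\dagger^k\langle t_j\rangle_{j\in g^{-1}(k)}\mid\delta_\dagger(t,\langle\langle y_j\rangle_{j\in g^{-1}(k)}.s_k\rangle_{k\in\mathcal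 K})$, with the usual rules for variables, $\lambda$ and application, and: for each $k\in\mathcal K$, from $\Gamma\vdash t_j:A_{f(j)}$ for all $j\in g^{-1}(k)$ infer $\Gamma\vdash\iota_\dagger^k\langle t_j\rangle:\dagger\langle A_i\rangle$; from $\Gamma\vdash t:\dagger\langle A_i\rangle$ and $\Gamma,\langle y_j:A_{f(j)}\rangle_{j\in g^{-1}(k)}\vdash s_k:C$ for all $k\in\mathcal K$ infer $\Gamma\vdash\delta_\dagger(t,\langle\langle y_j\rangle.s_k\rangle_k):C$. $\mathtt{NI}^2_{at}$ over $\mathcal L^2$: terms $x,\lambda x.t,tu,\Lambda X.t,tY$; System F typing ($\Lambda X.t:\forall X.A$ if $\Gamma\vdash t:A$, $X\notin FV(\Gamma)$) with type application restricted to variables: from $\Gamma\vdash t:\forall X.A$ infer $\Gamma\vdash tY:A\llbracket Y/X\rrbracket$, $Y$ a variable. Terms represent derivations; type information is regarded as part of the term, though not displayed, and the translation is defined by recursion on typing derivations. Contexts. A term context has a hole $[\ ]$; $\mathtt U[t]$ is capture-avoiding, $\mathtt U\{t\}$ variable-capturing, substitution for the hole. Elimination contexts of $\mathtt{NI}^p$: $\mathtt E::=[\ ]\mid\mathtt Eu\mid\delta_\dagger(\mathtt E,\langle\langle y_j\rangle.s_k\rangle)$. Conversions. In $\mathtt{NI}^p$, $\rightsquigarrow_{\beta\eta\gamma}$ is the relation on well-typed terms generated by reflexivity, transitivity, congruence and $(\lambda x.t)s\rightsquigarrow t\llbracket s/x\rrbracket$; $\delta_\dagger(\iota_\dagger^h\langle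 t_j\rangle,\langle\langle y_j\rangle.s_k\rangle_k)\rightsquigarrow s_h\llbracket\langle t_j\rangle/\langle y_j\rangle\rrbracket$; ($\supset\eta$) $\lambda x.tx\rightsquigarrow t$ ($x\notin FV(t)$); ($\dagger\eta$) $\delta_\dagger(t,\langle\langle y_j\rangle.\iota_\dagger^k\langle y_j\rangle\rangle_{k\in\mathcal K})\rightsquigarrow t$; ($\dagger\gamma$) $\mathtt E[\delta_\dagger(t,\langle\langle y_j\rangle.s_k\rangle_k)]\rightsquigarrow\delta_\dagger(t,\langle\langle y_j\rangle.\mathtt E[s_k]\rangle_k)$ for $\mathtt E$ an elimination context. In $\mathtt{NI}^2_{at}$, $\simeq_{\beta\eta}$ is the typed congruence (reflexive, symmetric, transitive) generated by $(\lambda x.t)s\simeq t\llbracket s/x\rrbracket$, $(\Lambda X.t)Y\simeq t\llbracket Y/X\rrbracket$, $\lambda x.tx\simeq t$ ($x\notin FV(t)$), $\Lambda X.tX\simeq t$ ($X\notin FV(t)$). Translation of formulas: $X^*=X$, $(A\supset B)^*=A^*\supset B^*$, $(\dagger\langle A_i\rangle)^*=\forall X.\langle\langle A_{f(j)}^*\rangle_{j\in g^{-1}(k)}\supset X\rangle_{k\in\mathcal K}\supset X$ ($X$ not free in any $A_i$); $\Gamma^*$ translates all types in $\Gamma$. Weak expansion contexts. $\mathsf{at}(B)$ is the rightmost variable of $B\in\mathcal L^2$. $\mathtt{El}_B,\mathtt{In}_B$ are defined with the same fresh variables in both: $\mathtt{El}_Z=\mathtt{In}_Z=[\ ]$ for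 $Z$ a variable; $\mathtt{El}_{C\supset D}=\mathtt{El}_D[[\ ]x]$, $\mathtt{In}_{C\supset D}=\lambda x.\mathtt{In}_D$; $\mathtt{El}_{\forall X.D}=\mathtt{El}_D[[\ ]X]$, $\mathtt{In}_{\forall X.D}=\Lambda X.\mathtt{In}_D$. (If the rightmost variable is bound in $B$, $\mathsf{at}(B)$ denotes the corresponding type variable used in $\mathtt{El}_B,\mathtt{In}_B$.) ESF-translation: $x^\sharp=x$, $(\lambda x.t)^\sharp=\lambda x.t^\sharp$, $(ts)^\sharp=t^\sharp s^\sharp$, $(\iota_\dagger^{k_0}\langle t_j\rangle)^\sharp=\Lambda X.\lambda\langle x_k\rangle_{k\in\mathcal K}.x_{k_0}\langle t_j^\sharp\rangle$, and for $\delta_\dagger(t,\langle\langle y_j\rangle.s_k\rangle):A$ with $Z=\mathsf{at}(A^* )$, $(\delta_\dagger(t,\langle\langle y_j\rangle.s_k\rangle))^\sharp=\mathtt{In}_{A^*}\{t^\sharp Z\langle\lambda\langle y_j\rangle.\mathtt{El}_{A^*}[s_k^\sharp]\rangle_{k\in\mathcal K}\}$. *)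

(* Defs.v *)
From mathcomp Require Import all_boot.

Set Implicit Arguments.
Unset Strict Implicit.
Unset Printing Implicit Defensive.

(** Binding is rendered by de Bruijn indices, for type variables as well as
    for term variables.  Terms are in Church style: they carry the types that
    make the typing derivation of a term unique, so that the translation of
    derivations is a function on terms. *)

Definition upren (r : nat -> nat) (n : nat) : nat :=
  if n is m.+1 then (r m).+1 else 0.

(** * Polynomial connectives and the formulas of L^p *)

Record connective := Connective {
  nI : nat;
  nJ : nat;
  nK : nat;
  cf : 'I_nJ -> 'I_nI;
  cg : 'I_nJ -> 'I_nK
}.

(** The sublist g^-1(k); [enum] lists it in increasing order (see
    [enum_fiber] below). *)
Definition fiber (c : connective) (k : 'I_(nK c)) : finType :=
  {j : 'I_(nJ c) | cg j == k}.

Definition fval (c : connective) (k : 'I_(nK c)) (j : fiber k) : 'I_(nJ c) :=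
  sval j.

Lemma enum_fiber (c : connective) (k : 'I_(nK c)) :
  [seq fval j | j <- enum (fiber k)] = [seq j <- enum 'I_(nJ c) | cg j == k].
Proof.
rewrite /fval enumT unlock.
etransitivity; first exact: (pmap_filter (@insubK _ _ {j | cg j == k})).
by rewrite -enumT; apply: eq_filter => j; apply: isSome_insub.
Qed.

(** L^p has no binder: [PVar n] is the [n]-th type variable. *)
Inductive pform :=
| PVar (X : nat)
| PImp (A B : pform)
| PDag (c : connective) (A : 'I_(nI c) -> pform).

(** * System NI^p *)

(** [pinj c A k ts] is iota_c^k <t_j>, of type [PDag c A];
    [pdel c A C t ss] is delta_c(t, <<y_j>.s_k>_k), with [t] of type
    [PDag c A] and result type [C].  The component [ss k] binds the variables
    y_j for [j : fiber k], the last one having index 0. *)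
Inductive ptm :=
| pvar (n : nat)
| plam (A : pform) (t : ptm)
| papp (t u : ptm)
| pinj (c : connective) (A : 'I_(nI c) -> pform) (k : 'I_(nK c))
    (ts : fiber k -> ptm)
| pdel (c : connective) (A : 'I_(nI c) -> pform) (C : pform) (t : ptm)
    (ss : 'I_(nK c) -> ptm).

Fixpoint pren (r : nat -> nat) (t : ptm) : ptm :=
  match t with
  | pvar n => pvar (r n)
  | plam A t => plam A (pren (upren r) t)
  | papp t u => papp (pren r t) (pren r u)
  | pinj c A k ts => pinj A (fun j => pren r (ts j))
  | pdel c A C t ss =>
      pdel A C (pren r t) (fun k => pren (iter #|fiber k| upren r) (ss k))
  end.

Definition pup (s : nat -> ptm) (n : nat) : ptm :=
  if n is m.+1 then pren succn (s m) else pvar 0.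

Fixpoint psubst (s : nat -> ptm) (t : ptm) : ptm :=
  match t with
  | pvar n => s n
  | plam A t => plam A (psubst (pup s) t)
  | papp t u => papp (psubst s t) (psubst s u)
  | pinj c A k ts => pinj A (fun j => psubst s (ts j))
  | pdel c A C t ss =>
      pdel A C (psubst s t) (fun k => psubst (iter #|fiber k| pup s) (ss k))
  end.

(** Simultaneous instantiation of the [size us] innermost variables; the last
    element of [us] replaces the variable of index 0. *)
Definition pinst (us : seq ptm) (t : ptm) : ptm :=
  psubst (fun n => nth (pvar (n - size us)) (rev us) n) t.

(** The context G, <y_j : A_f(j)>_j for j in g^-1(k). *)
Definition pext (G : seq pform) (c : connective) (A : 'I_(nI c) -> pform)
    (k : 'I_(nK c)) : seq pform :=
  rev [seq A (cf (fval j)) | j <- enum (fiber k)] ++ G.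

(** The variable y_j in the scope of <y_j>_j for j in g^-1(k). *)
Definition pbvar (c : connective) (k : 'I_(nK c)) (j : fiber k) : ptm :=
  pvar (rev_ord (enum_rank j)).

Inductive ptyped : seq pform -> ptm -> pform -> Prop :=
| ptyped_var G n A :
    onth G n = Some A -> ptyped G (pvar n) A
| ptyped_lam G A B t :
    ptyped (A :: G) t B -> ptyped G (plam A t) (PImp A B)
| ptyped_app G A B t u :
    ptyped G t (PImp A B) -> ptyped G u A -> ptyped G (papp t u) B
| ptyped_inj G c (A : 'I_(nI c) -> pform) k (ts : fiber k -> ptm) :
    (forall j, ptyped G (ts j) (A (cf (fval j)))) ->
    ptyped G (pinj A ts) (PDag A)
| ptyped_del G c (A : 'I_(nI c) -> pform) C t ss :
    ptyped G t (PDag A) ->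
    (forall k, ptyped (pext G A k) (ss k) C) ->
    ptyped G (pdel A C t ss) C.

(** Elimination contexts.  They bind nothing at the hole, so that [pfill E t]
    is capture-avoiding once [E] and [t] live in the same context. *)
Inductive pectx :=
| pehole
| peapp (E : pectx) (u : ptm)
| pedel (c : connective) (A : 'I_(nI c) -> pform) (C : pform) (E : pectx)
    (ss : 'I_(nK c) -> ptm).

Fixpoint pfill (E : pectx) (t : ptm) : ptm :=
  match E with
  | pehole => t
  | peapp E u => papp (pfill E t) u
  | pedel c A C E ss => pdel A C (pfill E t) ss
  end.

Fixpoint peren (r : nat -> nat) (E : pectx) : pectx :=
  match E with
  | pehole => pehole
  | peapp E u => peapp (peren r E) (pren r u)
  | pedel c A C E ss =>
      pedel A C (peren r E) (fun k => pren (iter #|fiber k| upren r) (ss k))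
  end.

Inductive pconv : seq pform -> ptm -> ptm -> pform -> Prop :=
| pconv_refl G t A :
    ptyped G t A -> pconv G t t A
| pconv_trans G t u v A :
    pconv G t u A -> pconv G u v A -> pconv G t v A
| pconv_lam G A B t t' :
    pconv (A :: G) t t' B -> pconv G (plam A t) (plam A t') (PImp A B)
| pconv_app G A B t t' u u' :
    pconv G t t' (PImp A B) -> pconv G u u' A ->
    pconv G (papp t u) (papp t' u') B
| pconv_inj G c (A : 'I_(nI c) -> pform) k (ts ts' : fiber k -> ptm) :
    (forall j, pconv G (ts j) (ts' j) (A (cf (fval j)))) ->
    pconv G (pinj A ts) (pinj A ts') (PDag A)
| pconv_del G c (A : 'I_(nI c) -> pform) C t t' ss ss' :
    pconv G t t' (PDag A) ->
    (forall k, pconv (pext G A k) (ss k) (ss' k) C) ->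
    pconv G (pdel A C t ss) (pdel A C t' ss') C
| pconv_imp_beta G A B t s :
    ptyped (A :: G) t B -> ptyped G s A ->
    pconv G (papp (plam A t) s) (pinst [:: s] t) B
| pconv_dag_beta G c (A : 'I_(nI c) -> pform) C h (ts : fiber h -> ptm) ss :
    (forall j, ptyped G (ts j) (A (cf (fval j)))) ->
    (forall k, ptyped (pext G A k) (ss k) C) ->
    pconv G (pdel A C (pinj A ts) ss)
      (pinst [seq ts j | j <- enum (fiber h)] (ss h)) C
| pconv_imp_eta G A B t :
    ptyped G t (PImp A B) ->
    pconv G (plam A (papp (pren succn t) (pvar 0))) t (PImp A B)
| pconv_dag_eta G c (A : 'I_(nI c) -> pform) t :
    ptyped G t (PDag A) ->
    pconv G (pdel A (PDag A) t (fun k => pinj A (@pbvar c k))) t (PDag A)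
| pconv_dag_gamma G c (A : 'I_(nI c) -> pform) C D E t ss :
    ptyped G (pfill E (pdel A C t ss)) D ->
    pconv G (pfill E (pdel A C t ss))
      (pdel A D t (fun k => pfill (peren (addn #|fiber k|) E) (ss k))) D.

(** * Formulas of L^2 and the system NI^2_at *)

Inductive fform :=
| FVar (X : nat)
| FImp (A B : fform)
| FAll (A : fform).

Fixpoint fform_ren (r : nat -> nat) (A : fform) : fform :=
  match A with
  | FVar X => FVar (r X)
  | FImp A B => FImp (fform_ren r A) (fform_ren r B)
  | FAll A => FAll (fform_ren (upren r) A)
  end.

Inductive ftm :=
| fvar (n : nat)
| flam (A : fform) (t : ftm)
| fapp (t u : ftm)
| ftlam (t : ftm)
| ftapp (t : ftm) (Y : nat).

(** [q] renames type variables, [r] term variables. *)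
Fixpoint fren (q r : nat -> nat) (t : ftm) : ftm :=
  match t with
  | fvar n => fvar (r n)
  | flam A t => flam (fform_ren q A) (fren q (upren r) t)
  | fapp t u => fapp (fren q r t) (fren q r u)
  | ftlam t => ftlam (fren (upren q) r t)
  | ftapp t Y => ftapp (fren q r t) (q Y)
  end.

Definition fup (s : nat -> ftm) (n : nat) : ftm :=
  if n is m.+1 then fren id succn (s m) else fvar 0.

Fixpoint fsubst (s : nat -> ftm) (t : ftm) : ftm :=
  match t with
  | fvar n => s n
  | flam A t => flam A (fsubst (fup s) t)
  | fapp t u => fapp (fsubst s t) (fsubst s u)
  | ftlam t => ftlam (fsubst (fun n => fren succn id (s n)) t)
  | ftapp t Y => ftapp (fsubst s t) Y
  end.

Definition finst (u t : ftm) : ftm :=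
  fsubst (fun n => if n is m.+1 then fvar m else u) t.

(** Only variables are ever substituted for type variables, hence
    substitution of [Y] for the type variable 0 is a renaming. *)
Definition tyinst (Y : nat) (n : nat) : nat := if n is m.+1 then m else Y.

Inductive ftyped : seq fform -> ftm -> fform -> Prop :=
| ftyped_var G n A :
    onth G n = Some A -> ftyped G (fvar n) A
| ftyped_lam G A B t :
    ftyped (A :: G) t B -> ftyped G (flam A t) (FImp A B)
| ftyped_app G A B t u :
    ftyped G t (FImp A B) -> ftyped G u A -> ftyped G (fapp t u) B
| ftyped_tlam G A t :
    ftyped (map (fform_ren succn) G) t A -> ftyped G (ftlam t) (FAll A)
| ftyped_tapp G A t Y :
    ftyped G t (FAll A) -> ftyped G (ftapp t Y) (fform_ren (tyinst Y) A).

Inductive fconv : seq fform -> ftm -> ftm -> fform -> Prop :=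
| fconv_refl G t A :
    ftyped G t A -> fconv G t t A
| fconv_sym G t u A :
    fconv G t u A -> fconv G u t A
| fconv_trans G t u v A :
    fconv G t u A -> fconv G u v A -> fconv G t v A
| fconv_lam G A B t t' :
    fconv (A :: G) t t' B -> fconv G (flam A t) (flam A t') (FImp A B)
| fconv_app G A B t t' u u' :
    fconv G t t' (FImp A B) -> fconv G u u' A ->
    fconv G (fapp t u) (fapp t' u') B
| fconv_tlam G A t t' :
    fconv (map (fform_ren succn) G) t t' A ->
    fconv G (ftlam t) (ftlam t') (FAll A)
| fconv_tapp G A t t' Y :
    fconv G t t' (FAll A) ->
    fconv G (ftapp t Y) (ftapp t' Y) (fform_ren (tyinst Y) A)
| fconv_imp_beta G A B t s :
    ftyped (A :: G) t B -> ftyped G s A ->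
    fconv G (fapp (flam A t) s) (finst s t) B
| fconv_all_beta G A t Y :
    ftyped (map (fform_ren succn) G) t A ->
    fconv G (ftapp (ftlam t) Y) (fren (tyinst Y) id t)
      (fform_ren (tyinst Y) A)
| fconv_imp_eta G A B t :
    ftyped G t (FImp A B) ->
    fconv G (flam A (fapp (fren id succn t) (fvar 0))) t (FImp A B)
| fconv_all_eta G A t :
    ftyped G t (FAll A) ->
    fconv G (ftlam (ftapp (fren succn id t) 0)) t (FAll A).

(** * Translation of formulas *)

Definition fimps (As : seq fform) (B : fform) : fform := foldr FImp B As.
Definition flams (As : seq fform) (t : ftm) : ftm := foldr flam t As.
Definition fapps (t : ftm) (us : seq ftm) : ftm := foldl fapp t us.

(** <B_f(j)>_j > X for j in g^-1(k), where X is a new type variable 0. *)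
Definition branch (c : connective) (B : 'I_(nI c) -> fform) (k : 'I_(nK c)) :
    fform :=
  fimps [seq fform_ren succn (B (cf (fval j))) | j <- enum (fiber k)] (FVar 0).

Fixpoint star (A : pform) : fform :=
  match A with
  | PVar X => FVar X
  | PImp A B => FImp (star A) (star B)
  | PDag c A =>
      FAll (fimps [seq branch (fun i => star (A i)) k | k <- enum 'I_(nK c)]
                  (FVar 0))
  end.

(** * Weak expansion contexts *)

(** [In B t] is In_B{t}.  Inside its hole there are [nimp B] new term
    variables and [nall B] new type variables. *)
Fixpoint In (B : fform) (t : ftm) : ftm :=
  match B with
  | FVar _ => t
  | FImp C D => flam C (In D t)
  | FAll D => ftlam (In D t)
  end.

Fixpoint nimp (B : fform) : nat :=
  match B with FVar _ => 0 | FImp _ D => (nimp D).+1 | FAll D => nimp D end.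

Fixpoint nall (B : fform) : nat :=
  match B with FVar _ => 0 | FImp _ D => nall D | FAll D => (nall D).+1 end.

(** [El p B t] is El_B[t] placed inside the hole of In_B, below [p] further
    term binders; its variables are those bound by In_B. *)
Fixpoint El (p : nat) (B : fform) (t : ftm) : ftm :=
  match B with
  | FVar _ => t
  | FImp _ D => El p D (fapp t (fvar (p + nimp D)))
  | FAll D => El p D (ftapp t (nall D))
  end.

(** at(B), as an index inside the hole of In_B. *)
Fixpoint at_ (B : fform) : nat :=
  match B with FVar Z => Z | FImp _ D => at_ D | FAll D => at_ D end.

(** * The ESF-translation *)

(** The renamings bring the translated subterms into the scope of the binders
    under which they are placed. *)
Fixpoint sharp (t : ptm) : ftm :=
  match t with
  | pvar n => fvar n
  | plam A t => flam (star A) (sharp t)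
  | papp t u => fapp (sharp t) (sharp u)
  | pinj c A k ts =>
      ftlam (flams [seq branch (fun i => star (A i)) k' | k' <- enum 'I_(nK c)]
        (fapps (fvar (rev_ord k))
          [seq fren succn (addn (nK c)) (sharp (ts j)) | j <- enum (fiber k)]))
  | pdel c A C t ss =>
      let B := star C in
      let q := addn (nall B) in
      let r := addn (nimp B) in
      In B (fapps (ftapp (fren q r (sharp t)) (at_ B))
        [seq flams [seq fform_ren q (star (A (cf (fval j)))) | j <- enum (fiber k)]
               (El #|fiber k| B
                 (fren q (iter #|fiber k| upren r) (sharp (ss k))))
        | k <- enum 'I_(nK c)])
  end.

(* Main.v *)
Require Import Defs.
From mathcomp Require Import all_boot.
From mathcomp Require Import zify.

Set Implicit Arguments.
Unset Strict Implicit.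
Unset Printing Implicit Defensive.

(** The relation [fred] is the untyped compatible closure of the beta and eta
    contractions of the target calculus.  Contracting preserves types
    (eta by strengthening, [ftyped_fren_inv]), so a reduction that starts from a
    typed term is a typed conversion ([fred_fconv]).  Since the translation
    preserves typing ([ftyped_sharp]), it is enough to join the translations of
    the two sides of each conversion rule by untyped reductions.

    The translation of an elimination is wrapped in weak expansions, which
    satisfy two cancellation laws.  Filling [El_B] with [In_B] contracts by beta
    alone to a renaming of the contents ([fred_ElIn]); filling [In_B] with
    [El_B] contracts to the original term by eta ([fred_InEl]).  Then:

    - beta for a connective: the encoded injection selects its branch
      ([fred_case]), the arguments are substituted, and the remaining weak
      expansion disappears by the second law ([fred_fdel_beta]);
    - eta for a connective: both laws apply ([fred_fdel_eta]);
    - gamma for an application: a single beta step moves the argument into the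
      branches ([fred_fdel_app]);
    - gamma for an elimination: one side reduces by beta, because the weak
      expansion along an encoded connective feeds the outer branches to each
      inner branch ([fred_fdel_del_l]); the other side reduces to the same term
      by the first law ([fred_fdel_del_r]).

    A general elimination context is treated by induction on its frames
    ([fconv_sharp_gamma]).  The congruence rules are lemmas on typed conversion
    ([fconv_finj], [fconv_fdel]), which need conversion to be stable under
    renaming ([fconv_fren]), and the beta rules need the translation to commute
    with substitution ([sharp_pinst]). *)

(** * Renaming of type variables *)

Lemma eq_upren r r' : r =1 r' -> upren r =1 upren r'.
Proof. by move=> e [|n] //=; rewrite e. Qed.

Lemma upren_id : upren id =1 id.
Proof. by case. Qed.

Lemma upren_comp q q' : upren q \o upren q' =1 upren (q \o q').
Proof. by case. Qed.

Lemma iter_upren p r n :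
  iter p upren r n = if n < p then n else p + r (n - p).
Proof.
elim: p n => [|p IH] [|n] //=.
by rewrite IH ltnS subSS; case: ifP.
Qed.

Lemma iter_upren_lt p r n : n < p -> iter p upren r n = n.
Proof. by rewrite iter_upren => ->. Qed.

Lemma iter_upren_add p r n : iter p upren r (p + n) = p + r n.
Proof. by rewrite iter_upren ltnNge leq_addr /= addKn. Qed.

Lemma eq_fform_ren q q' A : q =1 q' -> fform_ren q A = fform_ren q' A.
Proof.
elim: A q q' => [X|A IA B IB|A IA] q q' e /=; first by rewrite e.
- by rewrite (IA _ _ e) (IB _ _ e).
- by rewrite (IA _ _ (eq_upren e)).
Qed.

Lemma fform_ren_id q A : q =1 id -> fform_ren q A = A.
Proof.
elim: A q => [X|A IA B IB|A IA] q e /=; first by rewrite e.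
- by rewrite IA ?IB.
- by rewrite IA // => n; rewrite (eq_upren e) upren_id.
Qed.

Lemma fform_ren_comp q q' A :
  fform_ren q (fform_ren q' A) = fform_ren (q \o q') A.
Proof.
elim: A q q' => [X|A IA B IB|A IA] q q' //=; first by rewrite IA IB.
by rewrite IA (eq_fform_ren _ (upren_comp _ _)).
Qed.

Lemma fform_ren_inj q : injective q -> injective (fform_ren q).
Proof.
move=> qI A; elim: A q qI => [X|A IA B IB|A IA] q qI [Y|C D|C] //=.
- by case=> /qI ->.
- by case=> /(IA _ qI) -> /(IB _ qI) ->.
- case=> /IA -> //; move=> [|m] [|n] //= [] /qI -> //.
Qed.

(** * Simultaneous renaming of type variables and substitution of terms *)

(** [fsub q s t] renames the type variables of [t] by [q] and simultaneously
    replaces its term variables by [s]; [s] takes its values in the target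
    scope, so [q] does not act on them.  Both [fren] and [fsubst] are instances
    ([fren_fsubE], [fsubst_fsubE]), and [fsub] is closed under composition
    ([fsub_fsub]): equations between renamings and substitutions reduce to
    pointwise equations between functions on indices. *)
Fixpoint fsub (q : nat -> nat) (s : nat -> ftm) (t : ftm) : ftm :=
  match t with
  | fvar n => s n
  | flam A t => flam (fform_ren q A) (fsub q (fup s) t)
  | fapp t u => fapp (fsub q s t) (fsub q s u)
  | ftlam t => ftlam (fsub (upren q) (fun n => fren succn id (s n)) t)
  | ftapp t Y => ftapp (fsub q s t) (q Y)
  end.

Lemma eq_fup s s' : s =1 s' -> fup s =1 fup s'.
Proof. by move=> e [|n] //=; rewrite e. Qed.

Lemma eq_fsub q q' s s' t : q =1 q' -> s =1 s' -> fsub q s t = fsub q' s' t.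
Proof.
elim: t q q' s s' => [n|A t IH|t IHt u IHu|t IH|t IH Y] q q' s s' eq es //=.
- by rewrite (eq_fform_ren _ eq) (IH _ _ _ _ eq (eq_fup es)).
- by rewrite (IHt _ _ _ _ eq es) (IHu _ _ _ _ eq es).
- by rewrite (IH _ _ _ _ (eq_upren eq) (fun n => congr1 _ (es n))).
- by rewrite (IH _ _ _ _ eq es) eq.
Qed.

Lemma fren_fsubE q r t : fren q r t = fsub q (fvar \o r) t.
Proof.
elim: t q r => [n|A t IH|t IHt u IHu|t IH|t IH Y] q r //=.
- by rewrite IH; congr flam; apply: eq_fsub => // -[].
- by rewrite IHt IHu.
- by rewrite IH.
- by rewrite IH.
Qed.

Lemma eq_fren q q' r r' t : q =1 q' -> r =1 r' -> fren q r t = fren q' r' t.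
Proof.
by move=> eq er; rewrite !fren_fsubE; apply: eq_fsub => // n /=; rewrite er.
Qed.

Lemma fsubst_fsubE s t : fsubst s t = fsub id s t.
Proof.
elim: t s => [n|A t IH|t IHt u IHu|t IH|t IH Y] s //=.
- by rewrite IH fform_ren_id.
- by rewrite IHt IHu.
- by rewrite IH; congr ftlam; apply: eq_fsub => // n; rewrite upren_id.
- by rewrite IH.
Qed.

Lemma fsub_fren q s q' r t :
  fsub q s (fren q' r t) = fsub (q \o q') (s \o r) t.
Proof.
elim: t q s q' r => [n|A t IH|t IHt u IHu|t IH|t IH Y] q s q' r //=.
- by rewrite IH fform_ren_comp; congr flam; apply: eq_fsub => // -[].
- by rewrite IHt IHu.
- by rewrite IH; congr ftlam; apply: eq_fsub => // n; apply: upren_comp.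
- by rewrite IH.
Qed.

Lemma fren_comp q r q' r' t :
  fren q r (fren q' r' t) = fren (q \o q') (r \o r') t.
Proof. by rewrite fren_fsubE fsub_fren fren_fsubE. Qed.

Lemma fren_fsub q r q' s t :
  fren q r (fsub q' s t) = fsub (q \o q') (fren q r \o s) t.
Proof.
elim: t q r q' s => [n|A t IH|t IHt u IHu|t IH|t IH Y] q r q' s //=.
- rewrite IH fform_ren_comp; congr flam; apply: eq_fsub => // -[|n] //=.
  by rewrite !fren_comp; apply: eq_fren.
- by rewrite IHt IHu.
- rewrite IH; congr ftlam; apply: eq_fsub => n /=; first exact: upren_comp.
  by rewrite !fren_comp; apply: eq_fren.
- by rewrite IH.
Qed.

Lemma fsub_fsub q s q' s' t :
  fsub q s (fsub q' s' t) = fsub (q \o q') (fsub q s \o s') t.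
Proof.
elim: t q s q' s' => [n|A t IH|t IHt u IHu|t IH|t IH Y] q s q' s' //=.
- rewrite IH fform_ren_comp; congr flam; apply: eq_fsub => // -[|n] //=.
  by rewrite fsub_fren fren_fsub; apply: eq_fsub.
- by rewrite IHt IHu.
- rewrite IH; congr ftlam; apply: eq_fsub => n /=; first exact: upren_comp.
  by rewrite fsub_fren fren_fsub; apply: eq_fsub.
- by rewrite IH.
Qed.

Lemma fsub_id q s t : q =1 id -> s =1 fvar -> fsub q s t = t.
Proof.
elim: t q s => [n|A t IH|t IHt u IHu|t IH|t IH Y] q s eq es //=.
- by rewrite fform_ren_id // IH // => -[|n] //=; rewrite es.
- by rewrite IHt ?IHu.
- by rewrite IH // => n; rewrite ?es // (eq_upren eq) upren_id.
- by rewrite IH // eq.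
Qed.

Lemma fren_id q r t : q =1 id -> r =1 id -> fren q r t = t.
Proof. by move=> eq er; rewrite fren_fsubE fsub_id // => n /=; rewrite er. Qed.

(** [s] pushed below [a] type binders and [b] term binders. *)
Definition fups (a b : nat) (s : nat -> ftm) (n : nat) : ftm :=
  if n < b then fvar n else fren (addn a) (addn b) (s (n - b)).

Lemma fups_lt a b s n : n < b -> fups a b s n = fvar n.
Proof. by rewrite /fups => ->. Qed.

Lemma fups_add a b s n : fups a b s (b + n) = fren (addn a) (addn b) (s n).
Proof. by rewrite /fups ltnNge leq_addr /= addKn. Qed.

Lemma fups_fup a b s : fups a b (fup s) =1 fups a b.+1 s.
Proof.
move=> n; rewrite /fups; case: ltngtP => [lt_nb|lt_bn|->].
- by rewrite ltnW.
- rewrite ltnS leqNgt lt_bn /= subnS.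
  case E: (n - b) => [|m] /=; first by lia.
  by rewrite fren_comp; apply: eq_fren => i //=; rewrite addnS.
- by rewrite leqnn subnn /= addn0.
Qed.

Lemma fups_tup a b s :
  fups a b (fun n => fren succn id (s n)) =1 fups a.+1 b s.
Proof.
move=> n; rewrite /fups; case: ifP => // _.
by rewrite fren_comp; apply: eq_fren => m //=; rewrite addnS.
Qed.

Lemma fups0 s : fups 0 0 s =1 s.
Proof. by move=> n; rewrite /fups ltn0 subn0 fren_id. Qed.

Lemma fups_fvar a b r : fups a b (fvar \o r) =1 fvar \o iter b upren r.
Proof. by move=> n; rewrite /fups /= iter_upren; case: ifP. Qed.

Lemma iter_fup b s : iter b fup s =1 fups 0 b s.
Proof.
elim: b s => [|b IH] s n; first by rewrite fups0.
by rewrite iterSr IH fups_fup.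
Qed.

(** * Iterated abstraction and application *)

Lemma fsub_flams q s As t :
  fsub q s (flams As t) =
  flams (map (fform_ren q) As) (fsub q (fups 0 (size As) s) t).
Proof.
elim: As s => [|A As IH] s /=; first by apply: eq_fsub => // n; rewrite fups0.
rewrite IH; congr (flam _ (flams _ _)).
by apply: eq_fsub => // n; rewrite fups_fup.
Qed.

Lemma fren_flams q r As t :
  fren q r (flams As t) =
  flams (map (fform_ren q) As) (fren q (iter (size As) upren r) t).
Proof.
rewrite fren_fsubE fsub_flams fren_fsubE; congr flams.
by apply: eq_fsub => //; apply: fups_fvar.
Qed.

Lemma fsub_fapps q s t us :
  fsub q s (fapps t us) = fapps (fsub q s t) (map (fsub q s) us).
Proof. by rewrite /fapps; elim: us t => //= u us IH t; rewrite IH. Qed.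

Lemma fren_fapps q r t us :
  fren q r (fapps t us) = fapps (fren q r t) (map (fren q r) us).
Proof. by rewrite /fapps; elim: us t => //= u us IH t; rewrite IH. Qed.

(** * Weak expansion contexts *)

Lemma nimp_ren q B : nimp (fform_ren q B) = nimp B.
Proof. by elim: B q => [|A _ B IH|B IH] q //=; rewrite IH. Qed.

Lemma nall_ren q B : nall (fform_ren q B) = nall B.
Proof. by elim: B q => [|A _ B IH|B IH] q //=; rewrite IH. Qed.

Lemma fsub_In q s B t :
  fsub q s (In B t) =
  In (fform_ren q B)
     (fsub (iter (nall B) upren q) (fups (nall B) (nimp B) s) t).
Proof.
elim: B q s => [X|A _ B IH|B IH] q s /=.
- by apply: eq_fsub => // n; rewrite fups0.
- rewrite IH; congr (flam _ (In _ _)).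
  by apply: eq_fsub => // n; rewrite fups_fup.
- rewrite IH; congr (ftlam (In _ _)); apply: eq_fsub => n.
    by rewrite -iterSr.
  by rewrite fups_tup.
Qed.

Lemma fren_In q r B t :
  fren q r (In B t) =
  In (fform_ren q B)
     (fren (iter (nall B) upren q) (iter (nimp B) upren r) t).
Proof.
rewrite fren_fsubE fsub_In fren_fsubE; congr In.
by apply: eq_fsub => //; apply: fups_fvar.
Qed.

(** The hypotheses say that the variables bound by [In B] stay in place, up to
    the shift from [p] to [p'] of the term variables. *)
Lemma fsub_El q s p p' B t :
    (forall n, n < nall B -> q n = n) ->
    (forall n, n < nimp B -> s (p + n) = fvar (p' + n)) ->
  fsub q s (El p B t) = El p' B (fsub q s t).
Proof.
elim: B t => [X|A _ B IH|B IH] t //= eq es.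
- by rewrite IH //= ?es // => n lt_n; apply: es; apply: ltnW.
- by rewrite IH //= ?eq // => n lt_n; apply: eq; apply: ltnW.
Qed.

Lemma fren_El q r p p' B t :
    (forall n, n < nall B -> q n = n) ->
    (forall n, n < nimp B -> r (p + n) = p' + n) ->
  fren q r (El p B t) = El p' B (fren q r t).
Proof.
by move=> eq er; rewrite !fren_fsubE (fsub_El _ (p' := p')) // => n /er /= ->.
Qed.

(** * Untyped reduction *)

(** The reflexive, transitive and compatible closure of the beta and eta
    contractions, without typing conditions; in the eta rule for functions the
    annotation [A] is arbitrary. *)
Inductive fred : ftm -> ftm -> Prop :=
| fred_refl t : fred t t
| fred_trans t u v : fred t u -> fred u v -> fred t v
| fred_lam A t t' : fred t t' -> fred (flam A t) (flam A t')
| fred_app t t' u u' : fred t t' -> fred u u' -> fred (fapp t u) (fapp t' u')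
| fred_tlam t t' : fred t t' -> fred (ftlam t) (ftlam t')
| fred_tapp t t' Y : fred t t' -> fred (ftapp t Y) (ftapp t' Y)
| fred_imp_beta A t s : fred (fapp (flam A t) s) (finst s t)
| fred_all_beta t Y : fred (ftapp (ftlam t) Y) (fren (tyinst Y) id t)
| fred_imp_eta A t : fred (flam A (fapp (fren id succn t) (fvar 0))) t
| fred_all_eta t : fred (ftlam (ftapp (fren succn id t) 0)) t.

Lemma fred_eq t u : t = u -> fred t u.
Proof. by move=> ->; apply: fred_refl. Qed.

Lemma fred_flams As t t' : fred t t' -> fred (flams As t) (flams As t').
Proof. by move=> h; elim: As => //= A As; apply: fred_lam. Qed.

Lemma fred_fapps (T : Type) (e : seq T) (u u' : T -> ftm) t t' :
    fred t t' -> (forall x, fred (u x) (u' x)) ->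
  fred (fapps t (map u e)) (fapps t' (map u' e)).
Proof.
rewrite /fapps => ht hu; elim: e t t' ht => //= x e IH t t' ht.
by apply: IH; apply: fred_app.
Qed.

Lemma fred_In B t t' : fred t t' -> fred (In B t) (In B t').
Proof.
by elim: B => //= [A _ B IH|B IH] /IH h; [apply: fred_lam|apply: fred_tlam].
Qed.

Lemma fred_El p B t t' : fred t t' -> fred (El p B t) (El p B t').
Proof.
elim: B t t' => //= [A _ B IH|B IH] t t' h; apply: IH.
  by apply: fred_app => //; apply: fred_refl.
exact: fred_tapp.
Qed.

(** The substitution of the [size us] innermost variables by [us]; the last
    element of [us] replaces the variable of index 0. *)
Definition finsts (us : seq ftm) (n : nat) : ftm :=
  nth (fvar (n - size us)) (rev us) n.

Lemma finsts_ge us n : size us <= n -> finsts us n = fvar (n - size us).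
Proof. by move=> h; rewrite /finsts nth_default ?size_rev. Qed.

Lemma finsts_add us n : finsts us (size us + n) = fvar n.
Proof. by rewrite finsts_ge ?leq_addr // addKn. Qed.

Lemma finsts_map (f : ftm -> ftm) us n :
  n < size us -> finsts (map f us) n = f (finsts us n).
Proof.
move=> h; rewrite /finsts size_map -map_rev.
by rewrite (nth_map (fvar (n - size us))) ?size_rev.
Qed.

(** Successive beta steps amount to one simultaneous substitution. *)
Lemma fred_beta As us t :
  size As = size us -> fred (fapps (flams As t) us) (fsub id (finsts us) t).
Proof.
elim: us As t => [|u us IH] [|A As] t //= sz.
  rewrite fsub_id // => [|n]; first exact: fred_refl.
  by rewrite /finsts nth_nil /= subn0.
case: sz => sz.
apply: (@fred_trans _ (fapps (finst u (flams As t)) us)).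
  rewrite -(map_id us); apply: fred_fapps => [|x]; last exact: fred_refl.
  exact: fred_imp_beta.
rewrite /finst fsubst_fsubE fsub_flams.
set w := fsub _ _ t.
apply: fred_trans (IH _ _ _) _; first by rewrite size_map.
rewrite /w fsub_fsub.
rewrite (@eq_fsub _ id _ (finsts (u :: us))) //; first exact: fred_refl.
rewrite /finsts => n; rewrite /= /fups sz rev_cons nth_rcons size_rev.
case: ltngtP => [lt_n|lt_n|->] /=.
- by rewrite /finsts; apply: set_nth_default; rewrite size_rev.
- case E: (n - size us) => [|m] /=; first by lia.
  rewrite /finsts nth_default ?size_rev; last by lia.
  congr fvar; lia.
- rewrite subnn fren_fsubE fsub_fsub fsub_id //= => m.
  rewrite /= /finsts nth_default ?size_rev; last by lia.
  by congr fvar; lia.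
Qed.

(** An elimination context cancels an introduction context by beta: the
    variables bound by [In] are renamed to those used by [El], which sit
    under the [p] further term binders, and the other ones are lowered. *)
Lemma fred_ElIn p q B t :
  fred (El p B (In (fform_ren q B) t))
    (fren (fun n => if n < nall B then n else n - nall B)
          (fun n => if n < nimp B then p + n else n - nimp B) t).
Proof.
elim: B q t => [X|A _ B IH|B IH] q t /=.
- by rewrite fren_id => [|n|n]; rewrite ?subn0 //; apply: fred_refl.
- apply: fred_trans (fred_El _ _ (fred_imp_beta _ _ _)) _.
  rewrite /finst fsubst_fsubE fsub_In nall_ren nimp_ren.
  rewrite [fform_ren id _]fform_ren_id //.
  apply: fred_trans (IH _ _) _; rewrite fren_fsub [fren _ _ t]fren_fsubE.
  apply: fred_eq.
  apply: eq_fsub => n /=; rewrite ?iter_upren /fups /=.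
    by do !case: ifP; lia.
  case: (ltngtP n (nimp B)) => [lt_n|lt_n|->] /=.
  + by rewrite lt_n ltnW.
  + case E: (n - nimp B) => [|m] /=; first by lia.
    by congr fvar; do !case: ifP; lia.
  + by rewrite subnn leqnn; congr fvar; rewrite /=; case: ifP; lia.
- apply: fred_trans (fred_El _ _ (fred_all_beta _ _)) _.
  rewrite fren_In nall_ren nimp_ren fform_ren_comp.
  apply: fred_trans (IH _ _) _; rewrite fren_comp.
  apply: fred_eq.
  apply: eq_fren => n /=; rewrite iter_upren.
    rewrite /tyinst; case E: (n - nall B) => [|m] /=; do !case: ifP; lia.
  by do !case: ifP; lia.
Qed.

(** Conversely, [In B] around [El 0 B] is an iterated eta expansion. *)
Lemma fred_InEl B t :
  fred (In B (El 0 B (fren (addn (nall B)) (addn (nimp B)) t))) t.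
Proof.
elim: B t => [X|A _ B IH|B IH] t /=.
- by rewrite fren_id; [apply: fred_refl|..].
- apply: fred_trans (fred_imp_eta A t); apply: fred_lam.
  apply: fred_trans (IH _); rewrite /= fren_comp add0n addn0.
  apply: fred_eq.
  by congr (In _ (El _ _ (fapp _ _))); apply: eq_fren => n //=; rewrite addnS.
- apply: fred_trans (fred_all_eta t); apply: fred_tlam.
  apply: fred_trans (IH _); rewrite /= fren_comp addn0.
  apply: fred_eq.
  by congr (In _ (El _ _ (ftapp _ _))); apply: eq_fren => n //=; rewrite addnS.
Qed.

(** * Typing and subject reduction *)

(** [r] maps the variables of [G] to variables of [G'] whose types are renamed
    by [q]. *)
Definition cren (q r : nat -> nat) (G G' : seq fform) :=
  forall n A, onth G n = Some A -> onth G' (r n) = Some (fform_ren q A).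

(** [s] maps the variables of [G] to terms typed in [G'], their types being
    renamed by [q]. *)
Definition csub (q : nat -> nat) (s : nat -> ftm) (G G' : seq fform) :=
  forall n A, onth G n = Some A -> ftyped G' (s n) (fform_ren q A).

Lemma cren_up q r G G' A :
  cren q r G G' -> cren q (upren r) (A :: G) (fform_ren q A :: G').
Proof. by move=> h [|n] B /=; [case=> ->|apply: h]. Qed.

Lemma cren_tup q r G G' : cren q r G G' ->
  cren (upren q) r (map (fform_ren succn) G) (map (fform_ren succn) G').
Proof.
move=> h n A; rewrite !onth_map; case E: (onth G n) => [B|] //= [<-].
rewrite (h _ _ E) /= !fform_ren_comp; congr Some; exact: eq_fform_ren.
Qed.

Lemma fform_ren_tyinst q A Y :
  fform_ren (tyinst (q Y)) (fform_ren (upren q) A) =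
  fform_ren q (fform_ren (tyinst Y) A).
Proof. by rewrite !fform_ren_comp; apply: eq_fform_ren => -[]. Qed.

Lemma ftyped_fren q r G G' t A :
  ftyped G t A -> cren q r G G' -> ftyped G' (fren q r t) (fform_ren q A).
Proof.
move=> h; elim: h q r G' => /=
  [{}G n {}A h|{}G {}A B {}t _ IH|{}G {}A B {}t u _ IHt _ IHu|{}G {}A {}t _ IH
  |{}G {}A {}t Y _ IH] q r G' c.
- by apply: ftyped_var; apply: c.
- by apply: ftyped_lam; apply: IH; apply: cren_up.
- by apply: ftyped_app (IHu _ _ _ c); apply: (IHt _ _ _ c).
- by apply: ftyped_tlam; apply: IH; apply: cren_tup.
- by rewrite -fform_ren_tyinst; apply: ftyped_tapp; apply: (IH _ _ _ c).
Qed.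

Lemma cren_succ G A : cren id succn G (A :: G).
Proof. by move=> n B /= ->; rewrite fform_ren_id. Qed.

Lemma cren_tsucc G : cren succn id G (map (fform_ren succn) G).
Proof. by move=> n B; rewrite onth_map => ->. Qed.

Lemma csub_up q s G G' A :
  csub q s G G' -> csub q (fup s) (A :: G) (fform_ren q A :: G').
Proof.
move=> h [|n] B /=; first by case=> ->; apply: ftyped_var.
move=> /h hn; have := ftyped_fren hn (@cren_succ _ (fform_ren q A)).
by rewrite [fform_ren id _]fform_ren_id.
Qed.

Lemma csub_tup q s G G' : csub q s G G' ->
  csub (upren q) (fun n => fren succn id (s n))
    (map (fform_ren succn) G) (map (fform_ren succn) G').
Proof.
move=> h n A; rewrite !onth_map; case E: (onth G n) => [B|] //= [<-].
rewrite fform_ren_comp (@eq_fform_ren _ (succn \o q)) // -fform_ren_comp.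
by apply: (ftyped_fren (h _ _ E)); apply: cren_tsucc.
Qed.

Lemma ftyped_fsub q s G G' t A :
  ftyped G t A -> csub q s G G' -> ftyped G' (fsub q s t) (fform_ren q A).
Proof.
move=> h; elim: h q s G' => /=
  [{}G n {}A h|{}G {}A B {}t _ IH|{}G {}A B {}t u _ IHt _ IHu|{}G {}A {}t _ IH
  |{}G {}A {}t Y _ IH] q s G' c.
- exact: c.
- by apply: ftyped_lam; apply: IH; apply: csub_up.
- by apply: ftyped_app (IHu _ _ _ c); apply: (IHt _ _ _ c).
- by apply: ftyped_tlam; apply: IH; apply: csub_tup.
- by rewrite -fform_ren_tyinst; apply: ftyped_tapp; apply: (IH _ _ _ c).
Qed.

Lemma ftyped_finst G A B t s :
  ftyped (A :: G) t B -> ftyped G s A -> ftyped G (finst s t) B.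
Proof.
move=> ht hs; rewrite /finst fsubst_fsubE -(@fform_ren_id id B) //.
apply: (ftyped_fsub ht) => -[|n] C /=; rewrite fform_ren_id //.
  by case=> <-.
by move=> h; apply: ftyped_var.
Qed.

Lemma ftyped_tinst G A t Y :
  ftyped (map (fform_ren succn) G) t A ->
  ftyped G (fren (tyinst Y) id t) (fform_ren (tyinst Y) A).
Proof.
move=> ht; apply: (ftyped_fren ht) => n B; rewrite onth_map.
case: (onth G n) => [C|] //= [<-].
by rewrite fform_ren_comp fform_ren_id.
Qed.

Lemma ftyped_inv G t T : ftyped G t T ->
  match t with
  | fvar n => onth G n = Some T
  | flam A t => exists2 B, T = FImp A B & ftyped (A :: G) t B
  | fapp t u => exists2 A, ftyped G t (FImp A T) & ftyped G u A
  | ftlam t => exists2 A, T = FAll A & ftyped (map (fform_ren succn) G) t A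
  | ftapp t Y => exists2 A, T = fform_ren (tyinst Y) A & ftyped G t (FAll A)
  end.
Proof.
by case=> {G t T}
  [G n A|G A B t|G A B t u|G A t|G A t Y] //;
  [exists B|exists A|exists A|exists A].
Qed.

(** Strengthening: a typed term that is the renaming of [t] comes from a typing
    of [t] itself.  It makes the eta contractions preserve types. *)
Lemma ftyped_fren_inv q r G G' t A' :
    injective q ->
    (forall n A, onth G' (r n) = Some A ->
       exists2 B, A = fform_ren q B & onth G n = Some B) ->
    ftyped G' (fren q r t) A' ->
  exists2 A, A' = fform_ren q A & ftyped G t A.
Proof.
elim: t q r G G' A' => [n|A t IH|t IHt u IHu|t IH|t IH Y] q r G G' T qI c /=
  /ftyped_inv.
- by move/c=> [B -> h]; exists B => //; apply: ftyped_var.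
- case=> B -> h; case: (IH q (upren r) (A :: G) _ _ qI _ h) => [|C -> hC].
    by move=> [|n] D /=; [case=> <-; exists A|apply: c].
  by exists (FImp A C) => //; apply: ftyped_lam.
- case=> A /(IHt _ _ _ _ _ qI c) [[X|C D|D] //= [-> ->] ht].
  case/(IHu _ _ _ _ _ qI c) => C' /(fform_ren_inj qI) <- hu.
  by exists D => //; apply: ftyped_app hu.
- case=> A -> h.
  have qI' : injective (upren q) by move=> [|m] [|n] //= [/qI->].
  case: (IH (upren q) r (map (fform_ren succn) G) _ _ qI' _ h) => [|C -> hC].
    move=> n D; rewrite onth_map.
    case E: (onth G' (r n)) => [F|] //= [<-].
    have [B -> hB] := c _ _ E.
    exists (fform_ren succn B); last by rewrite onth_map hB.
    by rewrite !fform_ren_comp; apply: eq_fform_ren.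
  by exists (FAll C) => //; apply: ftyped_tlam.
- case=> A -> /(IH _ _ _ _ _ qI c) [[X|C D|D] //= [->] h].
  exists (fform_ren (tyinst Y) D); last exact: ftyped_tapp.
  exact: fform_ren_tyinst.
Qed.

Lemma fconv_ftyped G t u A : fconv G t u A -> ftyped G t A /\ ftyped G u A.
Proof.
elim=> {G t u A}.
- by [].
- by move=> G t u A _ [].
- by move=> G t u v A _ [ht _] _ [].
- by move=> G A B t t' _ [h h']; split; apply: ftyped_lam.
- by move=> G A B t t' u u' _ [ht ht'] _ [hu hu'];
    split; [apply: ftyped_app hu|apply: ftyped_app hu'].
- by move=> G A t t' _ [h h']; split; apply: ftyped_tlam.
- by move=> G A t t' Y _ [h h']; split; apply: ftyped_tapp.
- move=> G A B t s ht hs; split; last exact: ftyped_finst hs.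
  by apply: ftyped_app hs; apply: ftyped_lam.
- move=> G A t Y h; split; last exact: ftyped_tinst.
  by apply: ftyped_tapp; apply: ftyped_tlam.
- move=> G A B t h; split=> //; apply: ftyped_lam; apply: (@ftyped_app _ A).
    rewrite -(@fform_ren_id id (FImp A B)) //.
    exact: (ftyped_fren h (@cren_succ _ _)).
  exact: ftyped_var.
- move=> G A t h; split=> //; apply: ftyped_tlam.
  have := ftyped_tapp 0 (ftyped_fren h (@cren_tsucc G)).
  by rewrite fform_ren_comp fform_ren_id => // -[].
Qed.

(** Untyped reduction from a typed term stays within typed conversion, so that
    typing needs to be checked at the source only. *)
Lemma fred_fconv G t u A : ftyped G t A -> fred t u -> fconv G t u A.
Proof.
move=> h r; elim: r G A h => {t u}.
- by move=> t G A; apply: fconv_refl.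
- move=> t u v _ IH1 _ IH2 G A /IH1 h; apply: (fconv_trans h).
  by apply: IH2; apply: (fconv_ftyped h).2.
- by move=> A t t' _ IH G T /ftyped_inv [B -> /IH]; apply: fconv_lam.
- move=> t t' u u' _ IHt _ IHu G T /ftyped_inv [A /IHt ht /IHu].
  exact: fconv_app.
- by move=> t t' _ IH G T /ftyped_inv [A -> /IH]; apply: fconv_tlam.
- by move=> t t' Y _ IH G T /ftyped_inv [A -> /IH]; apply: fconv_tapp.
- move=> A t s G T /ftyped_inv [B /ftyped_inv [C [-> ->] ht] hs].
  exact: fconv_imp_beta.
- move=> t Y G T /ftyped_inv [B -> /ftyped_inv [C [->] ht]].
  exact: fconv_all_beta.
- move=> A t G T /ftyped_inv [B -> /ftyped_inv [C h /ftyped_inv /= [eA]]].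
  rewrite -eA in h; apply: fconv_imp_eta.
  case: (@ftyped_fren_inv id succn G _ _ _ _ _ h) => //.
    by move=> n D /= hn; exists D => //; rewrite fform_ren_id.
  by move=> D -> ; rewrite fform_ren_id.
- move=> t G T /ftyped_inv [B -> /ftyped_inv [C -> h]].
  case: (@ftyped_fren_inv succn id G _ _ _ _ _ h).
  + by move=> m n [].
  + move=> n D; rewrite onth_map; case: (onth G n) => [F|] //= [<-].
    by exists F.
  + case=> [|//|D /= [->] hD]; first by [].
    rewrite fform_ren_comp fform_ren_id => [|[]//].
    exact: fconv_all_eta.
Qed.

(** * Renaming of conversions *)

Lemma fren_finst q r s t :
  fren q r (finst s t) = finst (fren q r s) (fren q (upren r) t).
Proof.
rewrite /finst !fsubst_fsubE fren_fsub fsub_fren.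
by apply: eq_fsub => // -[].
Qed.

Lemma fred_fren q r t u : fred t u -> fred (fren q r t) (fren q r u).
Proof.
move=> h; elim: h q r => {t u} /=.
- by move=> *; apply: fred_refl.
- by move=> t u v _ IH1 _ IH2 q r; apply: fred_trans (IH1 _ _) (IH2 _ _).
- by move=> A t t' _ IH q r; apply: fred_lam.
- by move=> t t' u u' _ IH1 _ IH2 q r; apply: fred_app.
- by move=> t t' _ IH q r; apply: fred_tlam.
- by move=> t t' Y _ IH q r; apply: fred_tapp.
- by move=> A t s q r; rewrite fren_finst; apply: fred_imp_beta.
- move=> t Y q r; suff -> : fren q r (fren (tyinst Y) id t) =
    fren (tyinst (q Y)) id (fren (upren q) r t) by apply: fred_all_beta.
  by rewrite !fren_comp; apply: eq_fren => // -[].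
- move=> A t q r; suff -> : fren q (upren r) (fren id succn t) =
    fren id succn (fren q r t) by apply: fred_imp_eta.
  by rewrite !fren_comp; apply: eq_fren.
- move=> t q r; suff -> : fren (upren q) r (fren succn id t) =
    fren succn id (fren q r t) by apply: fred_all_eta.
  by rewrite !fren_comp; apply: eq_fren.
Qed.

Lemma fconv_fren q r G G' t u A : fconv G t u A -> cren q r G G' ->
  fconv G' (fren q r t) (fren q r u) (fform_ren q A).
Proof.
move=> h; elim: h q r G' => {G t u A} /=.
- by move=> G t A h q r G' c; apply: fconv_refl; apply: ftyped_fren c.
- by move=> G t u A _ IH q r G' c; apply: fconv_sym; apply: IH.
- by move=> G t u v A _ IH1 _ IH2 q r G' c;
    apply: fconv_trans (IH1 _ _ _ c) (IH2 _ _ _ c).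
- by move=> G A B t t' _ IH q r G' c;
    apply: fconv_lam; apply: IH; apply: cren_up.
- by move=> G A B t t' u u' _ IH1 _ IH2 q r G' c;
    apply: fconv_app (IH1 _ _ _ c) (IH2 _ _ _ c).
- by move=> G A t t' _ IH q r G' c;
    apply: fconv_tlam; apply: IH; apply: cren_tup.
- by move=> G A t t' Y _ IH q r G' c; rewrite -fform_ren_tyinst;
    apply: fconv_tapp; apply: (IH _ _ _ c).
- move=> G A B t s ht hs q r G' c.
  apply: fred_fconv; last exact: (fred_fren q r (fred_imp_beta A t s)).
  apply: (ftyped_fren (t := fapp (flam A t) s) _ c).
  by apply: ftyped_app hs; apply: ftyped_lam.
- move=> G A t Y ht q r G' c.
  apply: fred_fconv; last exact: (fred_fren q r (fred_all_beta t Y)).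
  apply: (ftyped_fren (t := ftapp (ftlam t) Y) _ c).
  by apply: ftyped_tapp; apply: ftyped_tlam.
- move=> G A B t ht q r G' c.
  apply: fred_fconv; last exact: (fred_fren q r (fred_imp_eta A t)).
  exact: (ftyped_fren (fconv_ftyped (fconv_imp_eta ht)).1 c).
- move=> G A t ht q r G' c.
  apply: fred_fconv; last exact: (fred_fren q r (fred_all_eta t)).
  exact: (ftyped_fren (fconv_ftyped (fconv_all_eta ht)).1 c).
Qed.

(** * Typed congruences *)

Lemma fconv_flams G As t t' B :
  fconv (rev As ++ G) t t' B ->
  fconv G (flams As t) (flams As t') (fimps As B).
Proof.
elim: As G => [|A As IH] G //=; rewrite rev_cons cat_rcons => h.
by apply: fconv_lam; apply: IH.
Qed.

Lemma fconv_fapps (T : Type) (e : seq T) (a : T -> fform) (u u' : T -> ftm)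
    G t t' B :
    fconv G t t' (fimps (map a e) B) ->
    (forall x, fconv G (u x) (u' x) (a x)) ->
  fconv G (fapps t (map u e)) (fapps t' (map u' e)) B.
Proof.
rewrite /fapps => ht hu; elim: e t t' ht => //= x e IH t t' ht.
by apply: IH; apply: fconv_app (hu x).
Qed.

(** The typing context in the hole of [In B]. *)
Fixpoint InCtx (G : seq fform) (B : fform) : seq fform :=
  match B with
  | FVar _ => G
  | FImp C D => InCtx (C :: G) D
  | FAll D => InCtx (map (fform_ren succn) G) D
  end.

Lemma onth_InCtx G B n A : onth G n = Some A ->
  onth (InCtx G B) (nimp B + n) = Some (fform_ren (addn (nall B)) A).
Proof.
elim: B G n A => [X|C _ D IH|D IH] G n A h.
- by rewrite fform_ren_id.
- by rewrite [nimp _]/= addSnnS; apply: (IH (C :: G)).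
- rewrite /= (IH _ _ (fform_ren succn A)) ?onth_map ?h // fform_ren_comp.
  by congr Some; apply: eq_fform_ren => m /=; rewrite addnS.
Qed.

Lemma cren_InCtx G B : cren (addn (nall B)) (addn (nimp B)) G (InCtx G B).
Proof. by move=> n A; apply: onth_InCtx. Qed.

Lemma fconv_In G B t t' :
  fconv (InCtx G B) t t' (FVar (at_ B)) -> fconv G (In B t) (In B t') B.
Proof.
elim: B G => [X|A _ B IH|B IH] G //= /IH; first exact: fconv_lam.
exact: fconv_tlam.
Qed.

(** [L] is the context of the term binders between [In B] and [El]; [t] has
    type [B] in the outer context, hence the renaming of its type. *)
Lemma fconv_El L G B t t' :
    fconv (L ++ InCtx G B) t t' (fform_ren (addn (nall B)) B) ->
  fconv (L ++ InCtx G B) (El (size L) B t) (El (size L) B t') (FVar (at_ B)).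
Proof.
elim: B G t t' => [X|A _ B IH|B IH] G t t' //= h.
- apply: IH; apply: fconv_app h _; apply: fconv_refl; apply: ftyped_var.
  have /= := @onth_InCtx (A :: G) B 0 A erefl; rewrite addn0 => <-.
  rewrite !onthE map_cat nth_cat size_map ltnNge leq_addr /=.
  by rewrite addnC addnK.
- apply: IH; move: (fconv_tapp (nall B) h); rewrite fform_ren_comp.
  rewrite (@eq_fform_ren _ (addn (nall B))) // => -[|m] /=.
    by rewrite addn0.
  by rewrite addnS.
Qed.

Lemma cren_iter_up q r G G' As : cren q r G G' ->
  cren q (iter (size As) upren r) (As ++ G) (map (fform_ren q) As ++ G').
Proof. by move=> c; elim: As => //= A As IH; apply: cren_up. Qed.

(** * Encoding of polynomial connectives in L^2 *)

Lemma size_enum_map (T : finType) (U : Type) (f : T -> U) :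
  size (map f (enum T)) = #|T|.
Proof. by rewrite size_map -cardE. Qed.

Lemma size_enum_ord_map n (U : Type) (f : 'I_n -> U) :
  size (map f (enum 'I_n)) = n.
Proof. by rewrite size_enum_map card_ord. Qed.

(** The variable bound at position [i] of an enumeration has index
    [rev_ord (enum_rank i)]. *)
Lemma nth_rev_enum (T : finType) (U : Type) (f : T -> U) (x : U) i :
  nth x (rev [seq f j | j <- enum T]) (rev_ord (enum_rank i)) = f i.
Proof.
have lt_i := ltn_ord (rev_ord (enum_rank i)).
rewrite nth_rev size_enum_map //.
have -> : #|T| - (rev_ord (enum_rank i)).+1 = enum_rank i.
  have lt_e := ltn_ord (enum_rank i).
  rewrite -[nat_of_ord (rev_ord _)]/(#|T| - (enum_rank i).+1) subnSK //.
  by rewrite subKn // ltnW.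
by rewrite (nth_map i) ?nth_enum_rank // -cardE.
Qed.

Lemma nth_rev_enum_ord n (T : Type) (f : 'I_n -> T) (x : T) k :
  nth x (rev [seq f i | i <- enum 'I_n]) (rev_ord k) = f k.
Proof.
rewrite nth_rev size_enum_ord_map; last exact: (ltn_ord (rev_ord k)).
have -> : n - (rev_ord k).+1 = k by have := ltn_ord k; rewrite /=; lia.
by rewrite (nth_map k) ?nth_ord_enum ?size_enum_ord.
Qed.

(** The second-order encoding of a connective, over arbitrary formulas [A] of
    L^2; the translation of [PDag] is an instance ([star_pdag]), and likewise
    for the introduction and the elimination below. *)
Definition fdag (c : connective) (A : 'I_(nI c) -> fform) : fform :=
  FAll (fimps [seq branch A k | k <- enum 'I_(nK c)] (FVar 0)).

(** The encoded introduction: it selects the [k]-th of the functions that it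
    abstracts, which has index [rev_ord k]. *)
Definition finj (c : connective) (A : 'I_(nI c) -> fform) (k : 'I_(nK c))
    (ts : fiber k -> ftm) : ftm :=
  ftlam (flams [seq branch A k' | k' <- enum 'I_(nK c)]
    (fapps (fvar (rev_ord k))
      [seq fren succn (addn (nK c)) (ts j) | j <- enum (fiber k)])).

(** The encoded elimination with result type [B]: the encoded term is
    instantiated at the rightmost variable of [B] only, and the weak expansion
    along [B] restores the result type. *)
Definition fdel (c : connective) (A : 'I_(nI c) -> fform) (B : fform) (t : ftm)
    (ss : 'I_(nK c) -> ftm) : ftm :=
  In B (fapps (ftapp (fren (addn (nall B)) (addn (nimp B)) t) (at_ B))
    [seq flams [seq fform_ren (addn (nall B)) (A (cf (fval j)))
                  | j <- enum (fiber k)]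
           (El #|fiber k| B
              (fren (addn (nall B)) (iter #|fiber k| upren (addn (nimp B)))
                 (ss k)))
       | k <- enum 'I_(nK c)]).

Lemma star_pdag c (A : 'I_(nI c) -> pform) :
  star (PDag A) = fdag (fun i => star (A i)).
Proof. by []. Qed.

Lemma sharp_pinj c (A : 'I_(nI c) -> pform) k (ts : fiber k -> ptm) :
  sharp (pinj A ts) = finj (fun i => star (A i)) (fun j => sharp (ts j)).
Proof. by []. Qed.

Lemma sharp_pdel c (A : 'I_(nI c) -> pform) C t ss :
  sharp (pdel A C t ss) =
  fdel (fun i => star (A i)) (star C) (sharp t) (fun k => sharp (ss k)).
Proof. by []. Qed.

Lemma eq_finj c (A : 'I_(nI c) -> fform) k (ts ts' : fiber k -> ftm) :
  ts =1 ts' -> finj A ts = finj A ts'.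
Proof.
by move=> e; congr (ftlam (flams _ (fapps _ _))); apply: eq_map => j; rewrite e.
Qed.

Lemma eq_fdel c (A : 'I_(nI c) -> fform) B t ss ss' :
  ss =1 ss' -> fdel A B t ss = fdel A B t ss'.
Proof.
by move=> e; congr (In _ (fapps _ _)); apply: eq_map => k; rewrite e.
Qed.

Lemma fform_ren_fimps q As B :
  fform_ren q (fimps As B) = fimps (map (fform_ren q) As) (fform_ren q B).
Proof. by elim: As => //= A As ->. Qed.

Lemma fform_ren_branch q Z c (B : 'I_(nI c) -> fform) k :
  fform_ren (tyinst Z) (fform_ren (upren q) (branch B k)) =
  fimps [seq fform_ren q (B (cf (fval j))) | j <- enum (fiber k)] (FVar Z).
Proof.
rewrite /branch !fform_ren_fimps -!map_comp /=; congr fimps.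
by apply: eq_map => j /=; rewrite !fform_ren_comp; apply: eq_fform_ren.
Qed.

(** The context of the branch [k] of a delta. *)
Definition fext (G : seq fform) (c : connective) (A : 'I_(nI c) -> fform)
    (k : 'I_(nK c)) : seq fform :=
  rev [seq A (cf (fval j)) | j <- enum (fiber k)] ++ G.

Lemma map_star_pext G c (A : 'I_(nI c) -> pform) k :
  map star (pext G A k) = fext (map star G) (fun i => star (A i)) k.
Proof. by rewrite map_cat map_rev -map_comp. Qed.

(** Applied to reflexive conversions, this and [fconv_finj] also give the typing
    of the encodings. *)
Lemma fconv_fdel G c (A : 'I_(nI c) -> fform) B t t' ss ss' :
    fconv G t t' (fdag A) ->
    (forall k, fconv (fext G A k) (ss k) (ss' k) B) ->
  fconv G (fdel A B t ss) (fdel A B t' ss') B.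
Proof.
move=> ht hs; apply: fconv_In.
set q := addn (nall B); set r := addn (nimp B).
pose a k := fimps [seq fform_ren q (A (cf (fval j))) | j <- enum (fiber k)]
  (FVar (at_ B)).
apply: (fconv_fapps (a := a)) => [|k].
  have /= := fconv_fren ht (@cren_InCtx _ B) => /(fconv_tapp (at_ B)).
  rewrite !fform_ren_fimps /= -!map_comp.
  by rewrite (@eq_map _ _ _ a) // => k /=; apply: fform_ren_branch.
apply: fconv_flams.
set L := rev _; have sL : size L = #|fiber k| by rewrite size_rev size_enum_map.
rewrite -sL; apply: fconv_El; apply: (fconv_fren (hs k)).
rewrite /fext; set L' := rev _.
have eL : L = map (fform_ren q) L' by rewrite /L /L' map_rev -map_comp.
by rewrite eL size_map; apply: cren_iter_up; exact: cren_InCtx.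
Qed.

Lemma fconv_finj G c (A : 'I_(nI c) -> fform) k (ts ts' : fiber k -> ftm) :
    (forall j, fconv G (ts j) (ts' j) (A (cf (fval j)))) ->
  fconv G (finj A ts) (finj A ts') (fdag A).
Proof.
move=> h; apply: fconv_tlam; apply: fconv_flams; set L := rev _.
have sL : size L = nK c by rewrite size_rev size_enum_ord_map.
apply: (fconv_fapps (a := fun j => fform_ren succn (A (cf (fval j))))).
  apply: fconv_refl; apply: ftyped_var.
  rewrite onthE map_cat nth_cat size_map sL (ltn_ord (rev_ord k)) map_rev.
  by rewrite -map_comp nth_rev_enum_ord.
move=> j; rewrite -(@eq_fren (id \o succn) _ (addn (nK c) \o id) _ _) //.
apply: (fconv_fren (h j)) => n B /= hn; rewrite -sL.
rewrite onthE map_cat nth_cat size_map ltnNge leq_addr /= addKn -onthE.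
by rewrite onth_map hn.
Qed.

Lemma ftyped_sharp G t A :
  ptyped G t A -> ftyped (map star G) (sharp t) (star A).
Proof.
elim=> {G t A}.
- by move=> G n A h; apply: ftyped_var; rewrite onth_map h.
- by move=> G A B t _; apply: ftyped_lam.
- by move=> G A B t u _ h _; apply: ftyped_app.
- move=> G c A k ts _ h; rewrite sharp_pinj star_pdag.
  exact: (fconv_ftyped (fconv_finj (fun j => fconv_refl (h j)))).1.
- move=> G c A C t ss _ ht _ hs; rewrite sharp_pdel.
  refine (fconv_ftyped (fconv_fdel (fconv_refl ht) (fun k => fconv_refl _))).1.
  by rewrite -map_star_pext.
Qed.

(** * Compatibility of the translation with substitution *)

Lemma fsub_fdel s c (A : 'I_(nI c) -> fform) B t ss :
  fsub id s (fdel A B t ss) =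
  fdel A B (fsub id s t) (fun k => fsub id (iter #|fiber k| fup s) (ss k)).
Proof.
rewrite /fdel fsub_In fform_ren_id //; congr In.
set a := nall B; set b := nimp B; set q0 := iter a upren id.
have q0E : q0 =1 id by move=> n; rewrite /q0 iter_upren; case: ifP => //=; lia.
rewrite fsub_fapps /= q0E -map_comp; congr (fapps (ftapp _ _) _).
  rewrite fsub_fren fren_fsub; apply: eq_fsub => n /=; first exact: q0E.
  by rewrite /fups ltnNge leq_addr /= addKn.
apply: eq_map => k /=; rewrite fsub_flams size_enum_map -map_comp.
congr flams; first by apply: eq_map => j /=; rewrite fform_ren_id.
rewrite (fsub_El _ (p' := #|fiber k|)) => [|n _|n lt_n]; last first.
- by rewrite /fups ltnNge leq_addr /= addKn lt_n.
- exact: q0E.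
congr El; rewrite fsub_fren fren_fsub; apply: eq_fsub => n /=; first exact: q0E.
rewrite iter_fup /= iter_upren /fups; case: (ltnP n #|fiber k|) => le_n.
  by rewrite le_n /= iter_upren le_n.
rewrite ltnNge leq_addr /= addKn ltnNge leq_addr /= addKn !fren_comp.
by apply: eq_fren => m //=; rewrite iter_upren ltnNge leq_addr /= addKn.
Qed.

Lemma fsub_finj s c (A : 'I_(nI c) -> fform) k (ts : fiber k -> ftm) :
  fsub id s (finj A ts) = finj A (fun j => fsub id s (ts j)).
Proof.
rewrite /finj /= fsub_flams fsub_fapps size_enum_ord_map; congr ftlam.
congr flams.
  rewrite -[RHS]map_id; apply: eq_map => B.
  by rewrite fform_ren_id //; apply: upren_id.
congr fapps; first by rewrite /= /fups (ltn_ord (rev_ord k)).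
rewrite -map_comp; apply: eq_map => j /=.
rewrite fsub_fren fren_fsub; apply: eq_fsub => n //=.
rewrite /fups ltnNge leq_addr /= addKn fren_comp.
by apply: eq_fren.
Qed.

Lemma sharp_pren r t : sharp (pren r t) = fren id r (sharp t).
Proof.
rewrite fren_fsubE.
elim: t r => [n|A t IH|t IHt u IHu|c A k ts IH|c A C t IHt ss IHs] r.
- by [].
- by rewrite /= IH fform_ren_id //; congr flam; apply: eq_fsub => // -[].
- by rewrite /= IHt IHu.
- by rewrite !sharp_pinj fsub_finj; apply: eq_finj => j; apply: IH.
- rewrite !sharp_pdel fsub_fdel IHt; apply: eq_fdel => k; rewrite IHs.
  apply: eq_fsub => // n; rewrite iter_fup /fups /= iter_upren.
  by case: ifP.
Qed.

Lemma sharp_psubst s t : sharp (psubst s t) = fsub id (sharp \o s) (sharp t).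
Proof.
have upE s' : sharp \o pup s' =1 fup (sharp \o s').
  by case=> [|n] //=; apply: sharp_pren.
elim: t s => [n|A t IH|t IHt u IHu|c A k ts IH|c A C t IHt ss IHs] s.
- by [].
- by rewrite /= IH fform_ren_id //; congr flam; apply: eq_fsub.
- by rewrite /= IHt IHu.
- by rewrite !sharp_pinj fsub_finj; apply: eq_finj => j; apply: IH.
- rewrite !sharp_pdel fsub_fdel IHt; apply: eq_fdel => k; rewrite IHs.
  apply: eq_fsub => // n; elim: #|fiber k| n => [|p IHp] n //=.
  by rewrite -/(comp sharp _ n) upE; apply: eq_fup.
Qed.

Lemma sharp_pinst us t :
  sharp (pinst us t) = fsub id (finsts (map sharp us)) (sharp t).
Proof.
rewrite /pinst sharp_psubst; apply: eq_fsub => // n /=.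
rewrite /finsts size_map -map_rev.
case: (ltnP n (size us)) => h.
  by rewrite (nth_map (pvar (n - size us))) ?size_rev.
by rewrite !nth_default ?size_map ?size_rev.
Qed.

(** * Weak expansion along an encoded connective *)

Lemma In_fimps As B t : In (fimps As B) t = flams As (In B t).
Proof. by elim: As => //= A As ->. Qed.

Lemma nimp_fimps As Z : nimp (fimps As (FVar Z)) = size As.
Proof. by elim: As => //= A As ->. Qed.

Lemma nall_fimps As Z : nall (fimps As (FVar Z)) = 0.
Proof. by elim: As. Qed.

Lemma at_fimps As Z : at_ (fimps As (FVar Z)) = Z.
Proof. by elim: As. Qed.

Lemma El_fimps p As Z t :
  El p (fimps As (FVar Z)) t =
  fapps t [seq fvar (p + i) | i <- rev (iota 0 (size As))].
Proof.
elim: As t => //= A As IH t; rewrite IH nimp_fimps.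
by rewrite -[0 :: _]/(iota 0 (size As).+1) -addn1 iotaD rev_cat.
Qed.

Lemma rev_enum_rank (T : finType) :
  [seq nat_of_ord (rev_ord (enum_rank x)) | x <- enum T] = rev (iota 0 #|T|).
Proof.
apply: (@eq_from_nth _ 0); rewrite size_enum_map ?size_rev ?size_iota //.
move=> i lt_i.
have x : T := enum_val (Ordinal lt_i).
rewrite nth_rev ?size_iota // nth_iota; last by lia.
rewrite (nth_map x) -?cardE //.
have -> : nth x (enum T) i = enum_val (Ordinal lt_i).
  by rewrite (enum_val_nth x).
by rewrite enum_valK.
Qed.

Lemma rev_enum_ord n :
  [seq nat_of_ord (rev_ord i) | i <- enum 'I_n] = rev (iota 0 n).
Proof.
rewrite (_ : iota 0 n = iota 0 #|'I_n|) -?rev_enum_rank.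
  by apply: eq_map => i /=; rewrite enum_rank_ord /= card_ord.
by rewrite card_ord.
Qed.

Lemma El_fdag p c (A : 'I_(nI c) -> fform) t :
  El p (fdag A) t =
  fapps (ftapp t 0) [seq fvar (p + rev_ord k) | k <- enum 'I_(nK c)].
Proof.
rewrite /= nall_fimps El_fimps size_enum_ord_map -rev_enum_ord -map_comp.
by [].
Qed.

Lemma nimp_fdag c (A : 'I_(nI c) -> fform) : nimp (fdag A) = nK c.
Proof. by rewrite /= nimp_fimps size_enum_ord_map. Qed.

Lemma nall_fdag c (A : 'I_(nI c) -> fform) : nall (fdag A) = 1.
Proof. by rewrite /= nall_fimps. Qed.

Lemma at_fdag c (A : 'I_(nI c) -> fform) : at_ (fdag A) = 0.
Proof. by rewrite /= at_fimps. Qed.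

(** * The beta and eta conversions of a connective *)

(** An encoded injection applied to [Z] and to one function per branch selects
    its branch. *)
Lemma fred_case q r Z c (A : 'I_(nI c) -> fform) h (ts : fiber h -> ftm)
    (v : 'I_(nK c) -> ftm) :
  fred (fapps (ftapp (fren q r (finj A ts)) Z) [seq v k | k <- enum 'I_(nK c)])
       (fapps (v h) [seq fren q r (ts j) | j <- enum (fiber h)]).
Proof.
rewrite /finj /=; apply: fred_trans.
  apply: fred_fapps (fun k => fred_refl (v k)); exact: fred_all_beta.
rewrite fren_flams size_enum_ord_map fren_flams size_map size_enum_ord_map.
apply: fred_trans.
  by apply: fred_beta; rewrite 2!size_map !size_enum_ord_map.
rewrite !fren_fapps fsub_fapps 2![fren _ _ (fvar _)]/= [fsub _ _ (fvar _)]/=.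
rewrite !(iter_upren_lt _ (ltn_ord (rev_ord h))).
set us := map v _; have su : size us = nK c by rewrite size_enum_ord_map.
have -> : finsts us (rev_ord h) = v h by apply: nth_rev_enum_ord.
rewrite -!map_comp.
apply: fred_eq.
congr fapps; apply: eq_map => j /=.
rewrite !fren_comp fsub_fren fren_fsubE; apply: eq_fsub => // n /=.
rewrite !iter_upren_add /finsts nth_default ?size_rev su ?leq_addr //.
by rewrite addKn.
Qed.

Lemma fred_fdel_beta c (A : 'I_(nI c) -> fform) B h (ts : fiber h -> ftm) ss :
  fred (fdel A B (finj A ts) ss)
       (fsub id (finsts [seq ts j | j <- enum (fiber h)]) (ss h)).
Proof.
apply: fred_trans; first by apply: fred_In; apply: fred_case.
apply: fred_trans.
  by apply: fred_In; apply: fred_beta; rewrite !size_map.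
rewrite (map_comp (fren _ _)); set us := map ts _; set us' := map _ us.
have su : size us = #|fiber h| by rewrite size_enum_map.
have finstsE n : finsts us' (#|fiber h| + n) = fvar n.
  by rewrite -su -(size_map (fren (addn (nall B)) (addn (nimp B)))) finsts_add.
rewrite (fsub_El _ (p' := 0)) => [|n _|n lt_n] //.
set t := fsub id _ (ss h); apply: fred_trans (fred_InEl B t).
apply: fred_eq.
congr (In _ (El _ _ _)); rewrite fsub_fren fren_fsub; apply: eq_fsub => // n.
rewrite [RHS]/= [LHS]/=; case: (ltnP n (size us)) => [lt_n|le_n].
  by rewrite -su iter_upren_lt // finsts_map.
by rewrite -(subnKC le_n) finsts_add su iter_upren_add finstsE.
Qed.

(** Both directions of weak expansion are used: the expansion at [fdag A] of the
    injection in a branch cancels by beta, leaving a variable expanded along the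
    type of the branch, and the whole term is then an eta expansion of [t]. *)
Lemma fred_fdel_eta c (A : 'I_(nI c) -> fform) t :
  fred (fdel A (fdag A) t (fun k =>
          finj A (fun j : fiber k => fvar (rev_ord (enum_rank j))))) t.
Proof.
apply: fred_trans (fred_InEl (fdag A) t); apply: fred_In.
rewrite El_fdag at_fdag; apply: fred_fapps (fred_refl _) _ => k.
set r := addn (nimp _); set q := addn (nall _); set p := #|fiber k|.
set As := map _ _.
pose Bk := fimps As (FVar 0).
(* The branch is the eta expansion of the variable bound by In for k. *)
apply: (@fred_trans _ (In Bk (El 0 Bk (fren (addn (nall Bk)) (addn (nimp Bk))
  (fvar (rev_ord k)))))); last first.
  exact: fred_InEl.
rewrite In_fimps El_fimps; apply: fred_flams.
have -> : size As = p by rewrite size_enum_map.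
rewrite -rev_enum_rank -map_comp.
have -> : finj A (fun j : fiber k => fvar (rev_ord (enum_rank j))) =
  In (fdag A) (fapps (fvar (rev_ord k))
    [seq fvar (nK c + rev_ord (enum_rank j)) | j <- enum (fiber k)]).
  by rewrite /= In_fimps.
rewrite fren_In; apply: fred_trans; first exact: fred_ElIn.
rewrite nimp_fdag !fren_fapps /= !iter_upren (ltn_ord (rev_ord k)) /=.
rewrite nimp_fimps size_enum_map (ltn_ord (rev_ord k)) -!map_comp.
apply: fred_eq.
congr fapps; apply: eq_map => j /=.
have lt_j := ltn_ord (rev_ord (enum_rank j)).
rewrite iter_upren_add iter_upren_lt //.
by rewrite ltnNge leq_addr /= addKn.
Qed.

(** * The gamma conversions *)

(** Commutation with an application: the first binder of [In (FImp C D)] is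
    consumed by [u], which is thereby carried into each branch. *)
Lemma fred_fdel_app c (A : 'I_(nI c) -> fform) C D t ss u :
  fred (fapp (fdel A (FImp C D) t ss) u)
       (fdel A D t (fun k => fapp (ss k) (fren id (addn #|fiber k|) u))).
Proof.
apply: fred_trans; first exact: fred_imp_beta.
rewrite /finst fsubst_fsubE fsub_In fform_ren_id //.
rewrite [nimp _]/= [nall _]/= [at_ _]/= /fdel.
set a := nall D; set b := nimp D; set s := fups a b _.
set q0 := iter a upren id.
have q0E : q0 =1 id by move=> n; rewrite /q0 iter_upren; case: ifP => //=; lia.
have sE n : s (b.+1 + n) = fvar (b + n).
  by rewrite /s /fups ltnNge leqW ?leq_addr //= addSn -addnS addKn.
rewrite fsub_fapps [fsub _ _ (ftapp _ _)]/= q0E -[map _ (map _ _)]map_comp.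
apply: fred_eq.
congr (In _ (fapps (ftapp _ _) _)).
  rewrite fsub_fren fren_fsubE; apply: eq_fsub => n; first exact: q0E.
  exact: sE.
apply: eq_map => k; rewrite [LHS]/= fsub_flams size_enum_map -map_comp.
congr flams; first by apply: eq_map => j /=; rewrite fform_ren_id.
set p := #|fiber k|.
rewrite (fsub_El _ (p' := p)) => [|n _|n lt_n]; last first.
- by rewrite /fups ltnNge leq_addr /= addKn /s /fups lt_n.
- exact: q0E.
congr El; rewrite [LHS]/= [RHS]/=; congr fapp.
  rewrite fsub_fren fren_fsubE; apply: eq_fsub => n /=; first exact: q0E.
  rewrite /fups !iter_upren; case: (ltnP n p) => [-> //|le_n].
  by rewrite ltnNge leq_addr addKn [RHS]/= sE.
rewrite /fups ltnNge leq_addr addKn /s /fups ltnn subnn /= !fren_comp.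
by apply: eq_fren => n //=; rewrite iter_upren_add.
Qed.

(** The common reduct of the two sides of the commutation of two eliminations:
    the outer case distinction is distributed over the branches of the inner
    one, inside a single [In D]. *)
Definition fdel_del_nf c (A : 'I_(nI c) -> fform) c' (A' : 'I_(nI c') -> fform)
    (D : fform) (t : ftm) (ss : 'I_(nK c) -> ftm) (rr : 'I_(nK c') -> ftm) :
    ftm :=
  let q := addn (nall D) in
  let r := addn (nimp D) in
  In D (fapps (ftapp (fren q r t) (at_ D))
    [seq flams [seq fform_ren q (A (cf (fval j))) | j <- enum (fiber k)]
       (fapps (ftapp (fren q (iter #|fiber k| upren r) (ss k)) (at_ D))
         [seq fren id (addn #|fiber k|)
            (flams [seq fform_ren q (A' (cf (fval j))) | j <- enum (fiber l)]
              (El #|fiber l| D (fren q (iter #|fiber l| upren r) (rr l))))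
         | l <- enum 'I_(nK c')])
    | k <- enum 'I_(nK c)]).

Lemma fdel_fdag c (A : 'I_(nI c) -> fform) c' (A' : 'I_(nI c') -> fform) t ss :
  fdel A (fdag A') t ss =
  ftlam (flams [seq branch A' l | l <- enum 'I_(nK c')]
    (fapps (ftapp (fren succn (addn (nK c')) t) 0)
      [seq flams [seq fform_ren succn (A (cf (fval j))) | j <- enum (fiber k)]
         (fapps
           (ftapp (fren succn (iter #|fiber k| upren (addn (nK c'))) (ss k)) 0)
           [seq fvar (#|fiber k| + rev_ord l) | l <- enum 'I_(nK c')])
      | k <- enum 'I_(nK c)])).
Proof.
rewrite /fdel nall_fdag nimp_fdag at_fdag.
under eq_map => k do rewrite El_fdag.
by rewrite /= In_fimps.
Qed.

(** On this side only beta steps along [fdag A'] are needed. *)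
Lemma fred_fdel_del_l c (A : 'I_(nI c) -> fform) c' (A' : 'I_(nI c') -> fform)
    D t ss rr :
  fred (fdel A' D (fdel A (fdag A') t ss) rr) (fdel_del_nf A A' D t ss rr).
Proof.
apply: fred_In; set q := addn (nall D); set r := addn (nimp D).
set v := (X in map X _); rewrite fdel_fdag.
rewrite (_ : forall t', fren q r (ftlam t') = ftlam (fren (upren q) r t')) //.
apply: fred_trans.
  apply: fred_fapps (fun l => fred_refl (v l)); exact: fred_all_beta.
rewrite fren_flams size_enum_ord_map fren_flams size_map size_enum_ord_map.
apply: fred_trans.
  by apply: fred_beta; rewrite 2!size_map !size_enum_ord_map.
rewrite fren_comp fsub_fren; set us := map v _.
have su : size us = nK c' by rewrite size_enum_ord_map.
(* What the two beta steps do to the body of the inner elimination: its type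
   variable becomes at(D), its nK c' term variables become the branches v. *)
set q1 := id \o _; set s1 := finsts us \o _.
have q1E n : q1 n.+1 = q n by [].
have q10 : q1 0 = at_ D by [].
have s1E n : s1 (nK c' + n) = fvar (r n).
  by rewrite /s1 /= !iter_upren_add -su finsts_add.
have s1_lt (l : 'I_(nK c')) : s1 (rev_ord l) = v l.
  rewrite /s1 [LHS]/= !(iter_upren_lt _ (ltn_ord (rev_ord l))).
  exact: nth_rev_enum_ord.
clearbody q1 s1.
rewrite fsub_fapps [fsub _ _ (ftapp _ _)]/= q10.
rewrite -[map _ (map _ (enum _))]map_comp.
apply: fred_eq.
congr (fapps (ftapp _ _) _).
  by rewrite fsub_fren fren_fsubE; apply: eq_fsub.
apply: eq_map => k; set p := #|fiber k|.
rewrite -[LHS]/(fsub q1 s1 (flams _ _)) fsub_flams size_enum_map -map_comp -/p.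
congr flams.
  by apply: eq_map => j /=; rewrite fform_ren_comp; apply: eq_fform_ren.
rewrite fsub_fapps -[fsub _ _ (ftapp _ _)]/(ftapp (fsub _ _ _) _) q10.
congr (fapps (ftapp _ _) _).
  rewrite fsub_fren fren_fsubE; apply: eq_fsub => // n.
  rewrite -[LHS]/(fups _ _ _ (iter _ _ _ _)) -[RHS]/(fvar (iter _ _ _ _)).
  case: (ltnP n p) => [lt_n|/subnKC <-].
    by rewrite !iter_upren_lt ?fups_lt.
  by rewrite !iter_upren_add fups_add s1E.
rewrite -[LHS]map_comp; apply: eq_map => l.
by rewrite -[LHS]/(fups _ _ _ (_ + rev_ord l)) fups_add s1_lt.
Qed.

(** On this side each branch contains [El] around [In] along [D], and they
    cancel. *)
Lemma fred_fdel_del_r c (A : 'I_(nI c) -> fform) c' (A' : 'I_(nI c') -> fform)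
    D t ss rr :
  fred (fdel A D t (fun k => fdel A' D (ss k)
         (fun l => fren id (iter #|fiber l| upren (addn #|fiber k|)) (rr l))))
       (fdel_del_nf A A' D t ss rr).
Proof.
apply: fred_In; apply: fred_fapps (fred_refl _) _ => k; apply: fred_flams.
rewrite /fdel fren_In.
set a := nall D; set b := nimp D; set p := #|fiber k|.
apply: fred_trans; first exact: fred_ElIn.
rewrite fren_comp; set Q := _ \o iter _ _ _; set R := _ \o iter _ _ _.
(* Q is the identity because the type variables bound by the two copies of
   In D are identified, and the others are first raised, then lowered. *)
have QE : Q =1 id.
  by move=> n; rewrite /Q /= iter_upren; do !case: ifP; rewrite /a; lia.
have RE n : R (b + n) = iter p upren (addn b) n.
  by rewrite /R /= iter_upren_add ltnNge leq_addr addKn.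
have R_lt n : n < b -> R n = p + n.
  by move=> lt_n; rewrite /R /= iter_upren_lt // lt_n.
clearbody Q R.
rewrite fren_fapps [fren _ _ (ftapp _ _)]/= QE -[map _ (map _ _)]map_comp.
apply: fred_eq.
congr (fapps (ftapp _ _) _).
  by rewrite fren_comp; apply: eq_fren => n; [apply: QE|apply: RE].
have mapQ q As : q =1 id -> map (fform_ren q) As = As.
  by move=> qE; rewrite -[RHS]map_id; apply: eq_map => B; apply: fform_ren_id.
apply: eq_map => l; set p' := #|fiber l|.
rewrite -[LHS]/(fren Q R (flams _ _)) !fren_flams size_enum_map -/p' !mapQ //.
congr flams.
rewrite !(fren_El _ (p' := p' + p)) => [|n|n lt_n|n|n lt_n] //; last first.
- by rewrite iter_upren_add R_lt // addnA.
- by rewrite iter_upren_add addnA.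
congr El; rewrite !fren_comp; apply: eq_fren => n; first exact: QE.
rewrite /=; case: (ltnP n p') => [lt_n|/subnKC <-].
  by rewrite !iter_upren_lt.
by rewrite !iter_upren_add RE iter_upren_add; lia.
Qed.

(** * Typing of the gamma conversions, and the translation of conversions *)

Lemma ptyped_inv G t T : ptyped G t T ->
  match t with
  | papp t u => exists2 A, ptyped G t (PImp A T) & ptyped G u A
  | pdel c A C t ss =>
      [/\ T = C, ptyped G t (PDag A) & forall k, ptyped (pext G A k) (ss k) C]
  | _ => True
  end.
Proof. by case=> // {}G A B {}t u; exists A. Qed.

(** [r] maps the variables of [G] to variables of [G'] of the same type. *)
Definition pcren (r : nat -> nat) (G G' : seq pform) :=
  forall n B, onth G n = Some B -> onth G' (r n) = Some B.

Lemma pcren_up r G G' A : pcren r G G' -> pcren (upren r) (A :: G) (A :: G').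
Proof. by move=> h [|n] C //=; apply: h. Qed.

Lemma pcren_pext r G G' c (A : 'I_(nI c) -> pform) k : pcren r G G' ->
  pcren (iter #|fiber k| upren r) (pext G A k) (pext G' A k).
Proof.
move=> cr; rewrite /pext; set L := rev _.
have -> : #|fiber k| = size L by rewrite size_rev size_enum_map.
by elim: (L) => //= B L' IHL; apply: pcren_up.
Qed.

Lemma pcren_addn G c (A : 'I_(nI c) -> pform) k :
  pcren (addn #|fiber k|) G (pext G A k).
Proof.
move=> n B; rewrite /pext; set L := rev _.
have -> : #|fiber k| = size L by rewrite size_rev size_enum_map.
by rewrite !onthE map_cat nth_cat size_map ltnNge leq_addr /= addKn.
Qed.

Lemma ptyped_pren r G G' t A :
  ptyped G t A -> pcren r G G' -> ptyped G' (pren r t) A.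
Proof.
move=> h; elim: h r G' => {G t A} /=.
- by move=> G n A h r G' cr; apply: ptyped_var; apply: cr.
- by move=> G A B t _ IH r G' cr; apply: ptyped_lam; apply: IH; apply: pcren_up.
- by move=> G A B t u _ IHt _ IHu r G' cr; apply: ptyped_app (IHu _ _ cr);
    apply: (IHt _ _ cr).
- by move=> G c A k ts _ IH r G' cr; apply: ptyped_inj => j; apply: IH.
- move=> G c A C t ss _ IHt _ IHs r G' cr.
  apply: ptyped_del (IHt _ _ cr) _ => k.
  by apply: IHs; apply: pcren_pext.
Qed.

Lemma ptyped_gamma G c (A : 'I_(nI c) -> pform) C D E t ss :
    ptyped G (pfill E (pdel A C t ss)) D ->
  ptyped G (pdel A D t (fun k => pfill (peren (addn #|fiber k|) E) (ss k))) D.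
Proof.
elim: E D => [|E IH u|c' A' C' E IH rr] D /=.
- by case/ptyped_inv=> -> ht hs; apply: ptyped_del ht hs.
- move/ptyped_inv=> [B /IH /ptyped_inv [_ ht hs] hu].
  apply: ptyped_del ht _ => k.
  by apply: ptyped_app (hs k) _; apply: (ptyped_pren hu); apply: pcren_addn.
- move/ptyped_inv=> [-> /IH /ptyped_inv [_ ht hs] hr].
  apply: ptyped_del ht _ => k.
  apply: ptyped_del (hs k) _ => l; apply: (ptyped_pren (hr l)).
  by apply: pcren_pext; apply: pcren_addn.
Qed.

(** By induction on the elimination context, one frame at a time. *)
Lemma fconv_sharp_gamma G c (A : 'I_(nI c) -> pform) C D E t ss :
    ptyped G (pfill E (pdel A C t ss)) D ->
  fconv (map star G) (sharp (pfill E (pdel A C t ss)))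
    (sharp (pdel A D t (fun k => pfill (peren (addn #|fiber k|) E) (ss k))))
    (star D).
Proof.
elim: E D => [|E IH u|c' A' C' E IH rr] D h.
- have [eD _ _] := ptyped_inv h; subst D; exact: fconv_refl (ftyped_sharp h).
- have [B /IH hE hu] := ptyped_inv h.
  apply: (fconv_trans (fconv_app hE (fconv_refl (ftyped_sharp hu)))).
  apply: fred_fconv.
    exact: (ftyped_app (fconv_ftyped hE).2 (ftyped_sharp hu)).
  rewrite !sharp_pdel; apply: fred_trans; first exact: fred_fdel_app.
  rewrite (eq_fdel _ _ _ (ss' := fun k => sharp (pfill
    (peren (addn #|fiber k|) (peapp E u)) (ss k)))); first exact: fred_refl.
  by move=> k /=; rewrite sharp_pren.
- have hR := ftyped_sharp (ptyped_gamma h).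
  have [eD /IH hE hr] := ptyped_inv h; subst C'.
  rewrite [sharp (pfill _ _)]sharp_pdel.
  have hL : fconv (map star G) (sharp (pfill (pedel A' D E rr) (pdel A C t ss)))
    (fdel (fun i => star (A' i)) (star D)
      (fdel (fun i => star (A i)) (fdag (fun i => star (A' i))) (sharp t)
        (fun k => sharp (pfill (peren (addn #|fiber k|) E) (ss k))))
      (fun l => sharp (rr l))) (star D).
    apply: fconv_fdel hE _ => l; apply: fconv_refl; rewrite -map_star_pext.
    exact: ftyped_sharp.
  have hM := fred_fconv (fconv_ftyped hL).2 (fred_fdel_del_l _ _ _ _ _ _).
  apply: (fconv_trans hL); apply: (fconv_trans hM); apply: fconv_sym.
  apply: (fred_fconv hR); rewrite sharp_pdel.
  apply: fred_trans; last exact: fred_fdel_del_r.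
  apply: fred_eq.
  apply: eq_fdel => k; rewrite [LHS]sharp_pdel; apply: eq_fdel => l.
  exact: sharp_pren.
Qed.

Theorem proposition12 (G : seq pform) (A : pform) (u v : ptm) :
  pconv G u v A ->
  fconv (map star G) (sharp u) (sharp v) (star A).
Proof.
elim=> {G A u v}.
- by move=> G t A /ftyped_sharp; apply: fconv_refl.
- by move=> G t u v A _ IH1 _ IH2; apply: fconv_trans IH1 IH2.
- by move=> G A B t t' _ IH; apply: fconv_lam.
- by move=> G A B t t' u u' _ IHt _ IHu; apply: fconv_app IHt IHu.
- by move=> G c A k ts ts' _ IH; apply: fconv_finj IH.
- move=> G c A C t t' ss ss' _ IHt _ IHs; apply: fconv_fdel IHt _ => k.
  by rewrite -map_star_pext.
- move=> G A B t s ht hs; rewrite sharp_pinst; apply: fred_fconv.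
    by apply: ftyped_sharp; apply: ptyped_app hs; apply: ptyped_lam.
  exact: (fred_beta (As := [:: star A]) (us := [:: sharp s])).
- move=> G c A C h ts ss hts hss; apply: fred_fconv.
    by apply: ftyped_sharp; apply: ptyped_del => //; apply: ptyped_inj.
  rewrite sharp_pinst -map_comp; exact: fred_fdel_beta.
- move=> G A B t ht; apply: fred_fconv.
    apply: ftyped_sharp; apply: ptyped_lam.
    apply: ptyped_app (ptyped_var _) => //.
    by apply: (ptyped_pren ht).
  by rewrite /= sharp_pren; apply: fred_imp_eta.
- move=> G c A t ht; apply: fred_fconv; last exact: fred_fdel_eta.
  apply: ftyped_sharp; apply: ptyped_del ht _ => k; apply: ptyped_inj => j.
  apply: ptyped_var; rewrite /pext onthE map_cat nth_cat size_map size_rev.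
  rewrite size_enum_map (ltn_ord (rev_ord (enum_rank j))) map_rev -map_comp.
  exact: nth_rev_enum.
- move=> G c A C D E t ss; exact: fconv_sharp_gamma.
Qed.
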